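(* Let $\Psi\colon\mathbb{R}^n\to\mathbb{R}^m$ be a vector positively homogeneous function with components $\psi_1,\dots,\psi_m$ such that, for every $i=1,\dots,m$, $\psi_i(z)\ge 0$ for all $z\in\mathbb{R}^{n_i}$ and $\psi_i(z)>0$ whenever $z\ne 0$. Let $c\in\mathbb{R}^n$, $d\in\mathbb{R}^m$, $b\in\mathbb{R}^k$, $p\in\mathbb{R}^\ell$, $A\in\mathbb{R}^{k\times n}$, $B\in\mathbb{R}^{k\times m}$, $H\in\mathbb{R}^{\ell\times n}$, $K\in\mathbb{R}^{\ell\times m}$ be given. Consider the positively homogeneous dual problem $$(\mathrm{D})\quad \max\ b^Tu+p^Tv\quad\text{s.t.}\quad \Psi^*(A^Tu+H^Tv-c)+B^Tu+K^Tv\le d,\ \ v\ge 0,$$ and the Lagrangian dual problem $$(\mathrm{D}_{\mathcal L})\quad \sup_{u\in\mathbb{R}^k,\ v\in\mathbb{R}^\ell,\ v\ge 0}\ \omega(u,v),\qquad \omega(u,v):=\inf_{x\in\mathbb{R}^n}\mathcal{L}(x,u,v),$$ where $$\mathcal{L}(x,u,v):=c^Tx+d^T\Psi(x)+u^T(b-Ax-B\Psi(x))+v^T(p-Hx-K\Psi(x)).$$ Suppose that $(\mathrm{D}_{\mathcal L})$ has a feasible solution. Then $(\mathrm{D})$ and $(\mathrm{D}_{\mathcal L})$ have the same optimal value and the same optimal solutions.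
   Context: $(\mathrm{D})$ and $(\mathrm{D}_{\mathcal L})$ are duals of the problem: minimize $c^Tx+d^T\Psi(x)$ subject to $Ax+B\Psi(x)=b$, $Hx+K\Psi(x)\ge p$. A function $\psi\colon\mathbb{R}^{q}\to\mathbb{R}$ is positively homogeneous if $\psi(\lambda x)=\lambda\psi(x)$ for all $x\in\mathbb{R}^q$ and all real $\lambda>0$. A map $\Psi\colon\mathbb{R}^n\to\mathbb{R}^m$ is vector positively homogeneous if $\Psi(x)=(\psi_1(x_{I_1}),\dots,\psi_m(x_{I_m}))^T$ for all $x\in\mathbb{R}^n$, where $I_1,\dots,I_m\subseteq\{1,\dots,n\}$ are pairwise disjoint index sets with $\#I_i=n_i$, $n=n_1+\cdots+n_m$, $x_{I_i}\in\mathbb{R}^{n_i}$ is the subvector of $x$ with entries indexed by $I_i$, and each $\psi_i\colon\mathbb{R}^{n_i}\to\mathbb{R}$ is positively homogeneous. The dual of a positively homogeneous function $\psi\colon\mathbb{R}^q\to\mathbb{R}$ is $\psi^*(y):=\sup\{x^Ty : \psi(x)\le 1\}$ for $y\in\mathbb{R}^q$. The dual vector positively homogeneous function associated to $\Psi$ is the real-valued map $\Psi^*\colon\mathbb{R}^n\to\mathbb{R}^m$, $\Psi^*(y)=(\psi_1^*(y_{I_1}),\dots,\psi_m^*(y_{I_m}))^T$, where $\psi_i^*\colon\mathbb{R}^{n_i}\to\mathbb{R}$ is the dual of $\psi_i$. Vector inequalities are componentwise. *)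

(* Defs.v *)
(* Vectors of R^q are columns of type 'cV[R]_q. *)
From HB Require Import structures.
From mathcomp Require Import all_boot all_order all_algebra.
From mathcomp Require Import all_classical all_reals all_analysis.

Set Implicit Arguments.
Unset Strict Implicit.
Unset Printing Implicit Defensive.

Import Order.TTheory GRing.Theory Num.Theory.

Local Open Scope classical_set_scope.
Local Open Scope ring_scope.

Definition dotp (R : realType) (q : nat) (x y : 'cV[R]_q) : R :=
  (x^T *m y) 0 0.

Definition vle (R : realType) (q : nat) (x y : 'cV[R]_q) : Prop :=
  forall i : 'I_q, x i 0 <= y i 0.

Definition pos_homogeneous (R : realType) (q : nat) (psi : 'cV[R]_q -> R)
    : Prop :=
  forall (lambda : R) (x : 'cV[R]_q),
    0 < lambda -> psi (lambda *: x) = lambda * psi x.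

(* [x_I]: the entries are listed in the increasing order of their indices. *)
Definition subvec (R : realType) (n : nat) (I : {set 'I_n}) (x : 'cV[R]_n)
    : 'cV[R]_#|I| :=
  \col_(j < #|I|) x (enum_val j) 0.

(* The dimension n_i is #|vph_I i|, so that the sum condition together with
   disjointness says that the index sets partition {0, ..., n-1}.  As usual for
   the domain R^{n_i} of a function, n_i is at least 1. *)
Record vph (R : realType) (n m : nat) := VPH {
  vph_I : 'I_m -> {set 'I_n};
  vph_psi : forall i : 'I_m, 'cV[R]_#|vph_I i| -> R;
  vph_disjoint : forall i j : 'I_m, i != j -> [disjoint vph_I i & vph_I j]%B;
  vph_sum : (\sum_(i < m) #|vph_I i|)%N = n;
  vph_gt0 : forall i : 'I_m, (0 < #|vph_I i|)%N;
  vph_homo : forall i : 'I_m, pos_homogeneous (@vph_psi i)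
}.

Definition vph_fun (R : realType) (n m : nat) (Psi : vph R n m)
    (x : 'cV[R]_n) : 'cV[R]_m :=
  \col_(i < m) vph_psi (subvec (vph_I Psi i) x).

Coercion vph_fun : vph >-> Funclass.

Definition dual_set (R : realType) (q : nat) (psi : 'cV[R]_q -> R)
    (y : 'cV[R]_q) : set R :=
  [set dotp x y | x in [set x | psi x <= 1]].

(* [sup] is the supremum in R; it has junk value 0 on a set without supremum,
   hence [dual_real_valued] below. *)
Definition ph_dual (R : realType) (q : nat) (psi : 'cV[R]_q -> R)
    (y : 'cV[R]_q) : R :=
  sup (dual_set psi y).

Definition vph_dual (R : realType) (n m : nat) (Psi : vph R n m)
    (y : 'cV[R]_n) : 'cV[R]_m :=
  \col_(i < m) ph_dual (@vph_psi _ _ _ Psi i) (subvec (vph_I Psi i) y).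

(* The suprema defining the dual functions exist in R.  This is not a
   consequence of positivity: psi may be discontinuous, and then its infimum on
   the unit sphere may be 0. *)
Definition dual_real_valued (R : realType) (n m : nat) (Psi : vph R n m)
    : Prop :=
  forall (i : 'I_m) (y : 'cV[R]_#|vph_I Psi i|),
    has_sup (dual_set (@vph_psi _ _ _ Psi i) y).

(* The problem of maximizing the extended real valued f over S.  Points of S at
   which f is -oo do not count as feasible solutions. *)
Definition feasible_solution (R : realType) (T : Type) (S : set T)
    (f : T -> \bar R) : set T :=
  [set z | S z /\ (-oo < f z)%E].

Definition opt_value (R : realType) (T : Type) (S : set T) (f : T -> \bar R)
    : \bar R :=
  ereal_sup [set f z | z in S].

Definition opt_solutions (R : realType) (T : Type) (S : set T)
    (f : T -> \bar R) : set T :=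
  [set z | S z /\ forall z', S z' -> (f z' <= f z)%E].

Definition D_constraint (R : realType) (n m k l : nat) (Psi : vph R n m)
    (c : 'cV[R]_n) (d : 'cV[R]_m) (A : 'M[R]_(k, n)) (B : 'M[R]_(k, m))
    (H : 'M[R]_(l, n)) (K : 'M[R]_(l, m)) : set ('cV[R]_k * 'cV[R]_l) :=
  [set uv | vle (vph_dual Psi (A^T *m uv.1 + H^T *m uv.2 - c)
                   + B^T *m uv.1 + K^T *m uv.2) d
            /\ vle 0 uv.2].

Definition D_objective (R : realType) (k l : nat) (b : 'cV[R]_k)
    (p : 'cV[R]_l) (uv : 'cV[R]_k * 'cV[R]_l) : \bar R :=
  (dotp b uv.1 + dotp p uv.2)%:E.

Definition lagrangian (R : realType) (n m k l : nat) (Psi : vph R n m)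
    (c : 'cV[R]_n) (d : 'cV[R]_m) (b : 'cV[R]_k) (p : 'cV[R]_l)
    (A : 'M[R]_(k, n)) (B : 'M[R]_(k, m))
    (H : 'M[R]_(l, n)) (K : 'M[R]_(l, m))
    (x : 'cV[R]_n) (u : 'cV[R]_k) (v : 'cV[R]_l) : R :=
  dotp c x + dotp d (Psi x) + dotp u (b - A *m x - B *m Psi x)
    + dotp v (p - H *m x - K *m Psi x).

Definition DL_constraint (R : realType) (k l : nat)
    : set ('cV[R]_k * 'cV[R]_l) :=
  [set uv | vle 0 uv.2].

Definition omega (R : realType) (n m k l : nat) (Psi : vph R n m)
    (c : 'cV[R]_n) (d : 'cV[R]_m) (b : 'cV[R]_k) (p : 'cV[R]_l)
    (A : 'M[R]_(k, n)) (B : 'M[R]_(k, m))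
    (H : 'M[R]_(l, n)) (K : 'M[R]_(l, m))
    (uv : 'cV[R]_k * 'cV[R]_l) : \bar R :=
  ereal_inf [set (lagrangian Psi c d b p A B H K x uv.1 uv.2)%:E
            | x in [set: 'cV[R]_n]].

(* Main.v *)
(* Writing y = A^T u + H^T v - c and e = d - B^T u - K^T v, the Lagrangian
   splits over the blocks:
     L(x,u,v) = b^T u + p^T v + sum_i (e_i psi_i(x_{I_i}) - y_{I_i}^T x_{I_i}).
   Each summand is positively homogeneous in x_{I_i}, so its infimum is 0 or
   -oo, and it is 0 exactly when psi_i^*(y_{I_i}) <= e_i.  Hence omega equals
   the objective of (D) on the feasible set of (D) and -oo elsewhere. *)
Require Import Defs.
From HB Require Import structures.
From mathcomp Require Import all_boot all_order all_algebra.
From mathcomp Require Import all_classical all_reals all_analysis.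
From mathcomp Require Import ring.

Set Implicit Arguments.
Unset Strict Implicit.
Unset Printing Implicit Defensive.

Import Order.TTheory GRing.Theory Num.Theory.

Local Open Scope classical_set_scope.
Local Open Scope ring_scope.

Lemma dotpE (R : realType) q (x y : 'cV[R]_q) :
  dotp x y = \sum_i x i 0 * y i 0.
Proof. by rewrite /dotp mxE; apply: eq_bigr => i _; rewrite mxE. Qed.

Lemma dotpC (R : realType) q (x y : 'cV[R]_q) : dotp x y = dotp y x.
Proof. by rewrite !dotpE; apply: eq_bigr => i _; rewrite mulrC. Qed.

Lemma dotpDr (R : realType) q (x y z : 'cV[R]_q) :
  dotp x (y + z) = dotp x y + dotp x z.
Proof. by rewrite /dotp mulmxDr mxE. Qed.

Lemma dotpNr (R : realType) q (x y : 'cV[R]_q) : dotp x (- y) = - dotp x y.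
Proof. by rewrite /dotp mulmxN mxE. Qed.

Lemma dotpZr (R : realType) q (a : R) (x y : 'cV[R]_q) :
  dotp x (a *: y) = a * dotp x y.
Proof. by rewrite /dotp -scalemxAr mxE. Qed.

Lemma dotp0r (R : realType) q (x : 'cV[R]_q) : dotp x 0 = 0.
Proof. by rewrite /dotp mulmx0 mxE. Qed.

Lemma dotpDl (R : realType) q (x y z : 'cV[R]_q) :
  dotp (x + y) z = dotp x z + dotp y z.
Proof. by rewrite dotpC dotpDr !(dotpC z). Qed.

Lemma dotpNl (R : realType) q (x y : 'cV[R]_q) : dotp (- x) y = - dotp x y.
Proof. by rewrite dotpC dotpNr dotpC. Qed.

Lemma dotp_mulmx (R : realType) q r (M : 'M[R]_(r, q)) (u : 'cV[R]_r)
  (x : 'cV[R]_q) : dotp u (M *m x) = dotp (M^T *m u) x.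
Proof. by rewrite /dotp trmx_mul trmxK mulmxA. Qed.

Section PositivelyHomogeneous.
Variables (R : realType) (q : nat) (psi : 'cV[R]_q -> R).
Hypothesis psi_homo : pos_homogeneous psi.

(** The scaling factor 0 is excluded from homogeneity; the factor 2 gives [psi 0 = 2 * psi 0]
    instead. *)
Lemma pos_homogeneous0 : psi 0 = 0.
Proof.
have := psi_homo 0 (ltr0n R 2 : 0 < 2%:R); rewrite scaler0 => h.
by apply: (addrI (psi 0)); rewrite addr0 [RHS]h mulr_natl mulr2n.
Qed.

Hypothesis psi_gt0 : forall z, z != 0 -> 0 < psi z.
Variable y : 'cV[R]_q.
Hypothesis dual_real : has_sup (dual_set psi y).

(** A Cauchy-Schwarz inequality for the pair [psi], [ph_dual psi]: for nonzero [z], the vector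
    [z / psi z] has [psi]-value 1, so it competes in the supremum. *)
Lemma dotp_le_ph_dual z : dotp y z <= ph_dual psi y * psi z.
Proof.
have [->|z0] := eqVneq z 0; first by rewrite dotp0r pos_homogeneous0 mulr0.
have pz := psi_gt0 z0.
rewrite -ler_pdivrMr// mulrC -dotpZr dotpC.
apply: (sup_upper_bound dual_real); exists ((psi z)^-1 *: z) => //=.
by rewrite psi_homo ?invr_gt0// mulVf// gt_eqF.
Qed.

(** Links the constraint of (D) on one block to the sign of that block's summand in the
    Lagrangian. *)
Lemma ph_dual_leP (e : R) : (0 < q)%N ->
  ph_dual psi y <= e <-> forall z, 0 <= e * psi z - dotp y z.
Proof.
move=> q0; split=> [le_e z|nneg].
  rewrite subr_ge0 (le_trans (dotp_le_ph_dual z))//.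
  have [->|z0] := eqVneq z 0; first by rewrite pos_homogeneous0 !mulr0.
  by rewrite ler_pM2r// psi_gt0.
(* Adding the inequalities at [z] and [- z] cancels the linear terms and leaves
   [e * (psi z + psi (- z)) >= 0], with no evenness of [psi]. A nonzero [z] exists because
   [0 < q]. *)
have e0 : 0 <= e.
  pose z : 'cV[R]_q := const_mx 1.
  have z0 : z != 0.
    apply/eqP => /matrixP /(_ (Ordinal q0) 0); rewrite !mxE => /eqP.
    by rewrite oner_eq0.
  have pz := psi_gt0 z0; have pNz : 0 < psi (- z) by rewrite psi_gt0// oppr_eq0.
  have := addr_ge0 (nneg z) (nneg (- z)).
  rewrite dotpNr opprK addrACA addNr addr0 -mulrDr.
  by rewrite pmulr_lge0// addr_gt0.
apply: ge_sup; first by case: dual_real.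
move=> _ [z /= pz1 <-]; rewrite dotpC.
have := nneg z; rewrite subr_ge0 => /le_trans; apply.
(* [e * psi z <= e] uses both [psi z <= 1] and [0 <= e]. *)
by rewrite ler_piMr.
Qed.

End PositivelyHomogeneous.

(** Extension by zero: [enum_val] is injective, so the sum has one term when [j] lies in [I] and is
    empty otherwise. *)
Definition embed (R : realType) n (I : {set 'I_n}) (z : 'cV[R]_#|I|) :
  'cV[R]_n := \col_j \sum_(a | enum_val a == j) z a 0.

Lemma subvec_embed (R : realType) n (I : {set 'I_n}) (z : 'cV[R]_#|I|) :
  subvec I (embed z) = z.
Proof.
apply/colP => a; rewrite !mxE (big_pred1 a) // => a'.
by rewrite (inj_eq enum_val_inj).
Qed.

Lemma subvec_embed_disjoint (R : realType) n (I J : {set 'I_n})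
    (z : 'cV[R]_#|I|) :
  [disjoint I & J]%B -> subvec J (embed z) = 0.
Proof.
move=> dIJ; apply/colP => a; rewrite !mxE big_pred0// => a'.
apply/negbTE/eqP => aa'.
have := disjointFr dIJ (enum_valP a').
by rewrite aa' enum_valP.
Qed.

(** By counting: the union of the disjoint index sets has as many elements as their sizes add up to,
    namely [n]. *)
Lemma vph_cover (R : realType) n m (Psi : vph R n m) :
  (\bigcup_i vph_I Psi i = [set: 'I_n])%SET.
Proof.
apply/eqP; rewrite eqEcard finset.subsetT cardsT card_ord /=.
rewrite -{1}(vph_sum Psi) -sum1_card partition_disjoint_bigcup.
  by apply: leq_sum => i _; rewrite sum1_card.
exact: vph_disjoint.
Qed.

Lemma dotp_subvec (R : realType) n m (Psi : vph R n m) (y x : 'cV[R]_n) :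
  dotp y x =
    \sum_i dotp (subvec (vph_I Psi i) y) (subvec (vph_I Psi i) x).
Proof.
rewrite dotpE (eq_bigl (mem (\bigcup_i vph_I Psi i)%SET)); last first.
  by move=> j; rewrite vph_cover; apply/esym; exact: finset.in_setT.
rewrite partition_disjoint_bigcup; last exact: vph_disjoint.
apply: eq_bigr => i _; rewrite dotpE big_enum_val.
by apply: eq_bigr => a _; rewrite !mxE.
Qed.

Lemma lagrangianE (R : realType) (n m k l : nat) (Psi : vph R n m)
    (c : 'cV[R]_n) (d : 'cV[R]_m) (b : 'cV[R]_k) (p : 'cV[R]_l)
    (A : 'M[R]_(k, n)) (B : 'M[R]_(k, m))
    (H : 'M[R]_(l, n)) (K : 'M[R]_(l, m)) x u v :
  lagrangian Psi c d b p A B H K x u v =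
  dotp b u + dotp p v +
  \sum_i ((d - B^T *m u - K^T *m v) i 0 * vph_psi (subvec (vph_I Psi i) x)
     - dotp (subvec (vph_I Psi i) (A^T *m u + H^T *m v - c))
            (subvec (vph_I Psi i) x)).
Proof.
rewrite sumrB -dotp_subvec.
have -> : \sum_i (d - B^T *m u - K^T *m v) i 0
    * vph_psi (subvec (vph_I Psi i) x) =
    dotp (d - B^T *m u - K^T *m v) (Psi x).
  by rewrite dotpE; apply: eq_bigr => i _; rewrite [Psi x i 0]mxE.
rewrite /lagrangian !(dotpDr, dotpNr, dotpDl, dotpNl) !dotp_mulmx.
rewrite (dotpC b) (dotpC p); ring.
Qed.

Lemma vle_vph_dual (R : realType) (n m : nat) (Psi : vph R n m)
    (y : 'cV[R]_n) (f g d : 'cV[R]_m) :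
  vle (vph_dual Psi y + f + g) d <->
  forall i, ph_dual (@vph_psi _ _ _ Psi i) (subvec (vph_I Psi i) y)
    <= (d - f - g) i 0.
Proof. by split=> le_d i; have := le_d i; rewrite !mxE !lerBrDr addrAC. Qed.

Lemma omega_on_D (R : realType) (n m k l : nat) (Psi : vph R n m)
    (Psi_real_dual : dual_real_valued Psi)
    (Psi_gt0 : forall (i : 'I_m) (z : 'cV[R]_#|vph_I Psi i|),
       z != 0 -> 0 < vph_psi z)
    (c : 'cV[R]_n) (d : 'cV[R]_m) (b : 'cV[R]_k) (p : 'cV[R]_l)
    (A : 'M[R]_(k, n)) (B : 'M[R]_(k, m))
    (H : 'M[R]_(l, n)) (K : 'M[R]_(l, m)) uv :
  D_constraint Psi c d A B H K uv ->
  omega Psi c d b p A B H K uv = D_objective b p uv.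
Proof.
case=> /vle_vph_dual dual_le _; apply/eqP; rewrite eq_le; apply/andP; split.
  (* The infimum is attained at [x = 0], where every block summand vanishes. *)
  apply: ereal_inf_lbound; exists 0 => //.
  rewrite lagrangianE big1 ?addr0// => i _.
  have -> : subvec (vph_I Psi i) 0 = 0 :> 'cV[R]_#|vph_I Psi i|.
    by apply/colP => a; rewrite !mxE.
  by rewrite dotp0r (pos_homogeneous0 (@vph_homo _ _ _ Psi i)) mulr0 subr0.
apply: le_ereal_inf_tmp => _ [x _ <-].
rewrite lee_fin lagrangianE lerDl sumr_ge0// => i _.
apply: (ph_dual_leP (@vph_homo _ _ _ Psi i) (@Psi_gt0 i)
  (@Psi_real_dual i _) _ (vph_gt0 Psi i)).1.
exact: dual_le.
Qed.

(** A violated constraint yields a block vector [z] with negative summand; along the ray through [z]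
    the Lagrangian decreases linearly without bound. *)
Lemma omega_off_D (R : realType) (n m k l : nat) (Psi : vph R n m)
    (Psi_real_dual : dual_real_valued Psi)
    (Psi_gt0 : forall (i : 'I_m) (z : 'cV[R]_#|vph_I Psi i|),
       z != 0 -> 0 < vph_psi z)
    (c : 'cV[R]_n) (d : 'cV[R]_m) (b : 'cV[R]_k) (p : 'cV[R]_l)
    (A : 'M[R]_(k, n)) (B : 'M[R]_(k, m))
    (H : 'M[R]_(l, n)) (K : 'M[R]_(l, m)) uv :
  DL_constraint uv -> ~ D_constraint Psi c d A B H K uv ->
  omega Psi c d b p A B H K uv = -oo%E.
Proof.
case: uv => u v v0 nD.
set e := d - B^T *m u - K^T *m v.
set y := A^T *m u + H^T *m v - c.
have [i [z neg]] : exists i, exists z : 'cV[R]_#|vph_I Psi i|,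
    e i 0 * vph_psi z - dotp (subvec (vph_I Psi i) y) z < 0.
  (* Since [v >= 0] holds, only the inequality on [vph_dual] can fail. *)
  apply: contrapT => none; apply: nD; split=> //=; apply/vle_vph_dual => i.
  apply/(ph_dual_leP (@vph_homo _ _ _ Psi i) (@Psi_gt0 i)
    (@Psi_real_dual i _) _ (vph_gt0 Psi i)) => z.
  by rewrite leNgt; apply/negP => lt0; apply: none; exists i, z.
set g := _ - _ in neg.
have lagr t : 0 < t ->
    lagrangian Psi c d b p A B H K (embed (t *: z)) u v =
    dotp b u + dotp p v + t * g.
  (* Only block [i] sees the embedded vector; all other blocks are evaluated at 0. *)
  move=> t0; rewrite lagrangianE (bigD1 i)//= big1 ?addr0.
    by rewrite subvec_embed vph_homo// dotpZr mulrCA -mulrBr.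
  move=> j ji; rewrite subvec_embed_disjoint; last first.
    by apply: vph_disjoint; rewrite eq_sym.
  by rewrite dotp0r (pos_homogeneous0 (@vph_homo _ _ _ Psi j)) mulr0 subr0.
apply: eq_ninfty => r.
(* With [t = (|s| + 1) / - g] the Lagrangian equals [r + s - |s| - 1], which is below [r]. The
   absolute value keeps [t] positive whatever the sign of [s]. *)
pose s := dotp b u + dotp p v - r.
have t0 : 0 < (`|s| + 1) / - g by rewrite divr_gt0 ?oppr_gt0// ltr_wpDl.
apply: (@le_trans _ _
  (dotp b u + dotp p v + (`|s| + 1) / - g * g)%:E).
  by rewrite -lagr//; apply: ereal_inf_lbound; eexists.
rewrite lee_fin invrN mulrN mulNr divfK ?lt_eqF// lerBlDl -lerBlDr.
by rewrite (le_trans (ler_norm s))// lerDl.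
Qed.

(** Points of value [-oo] affect neither the supremum nor, once some point has a larger value, the
    set of maximizers. Without such a point, every element of [S'] would be optimal. *)
Lemma opt_extend (R : realType) (T : Type) (S S' : set T) (f f' : T -> \bar R) :
  S `<=` S' -> (forall z, S z -> f' z = f z) ->
  (forall z, S' z -> ~ S z -> f' z = -oo%E) ->
  feasible_solution S' f' !=set0 ->
  opt_value S f = opt_value S' f' /\ opt_solutions S f = opt_solutions S' f'.
Proof.
move=> SS' on off [z0 [S'z0 fz0]].
split.
  apply/eqP; rewrite eq_le; apply/andP; split; apply: ge_ereal_sup.
    move=> _ [z Sz <-]; rewrite -on//; apply: ereal_sup_ubound.
    by exists z => //; exact: SS'.
  move=> _ [z S'z <-]; have [Sz|nSz] := pselect (S z).
    by rewrite on//; apply: ereal_sup_ubound; exists z.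
  by rewrite off// leNye.
apply/seteqP; split=> z [Sz opt]; split.
- exact: SS'.
- move=> z' S'z'; have [Sz'|nSz'] := pselect (S z').
    by rewrite !on//; exact: opt.
  by rewrite off// leNye.
(* A maximizer outside [S] would have value [-oo], strictly below the value at [z0]. *)
- apply: contrapT => nSz; have := opt _ S'z0.
  by rewrite (off z)// leNgt fz0.
- have Sz1 : S z.
    apply: contrapT => nSz; have := opt _ S'z0.
    by rewrite (off z)// leNgt fz0.
  by move=> z' Sz'; rewrite -!on//; apply/opt/SS'.
Qed.

Theorem theorem5 (R : realType) (n m k l : nat) (Psi : vph R n m)
    (Psi_real_dual : dual_real_valued Psi)
    (Psi_ge0 : forall (i : 'I_m) (z : 'cV[R]_#|vph_I Psi i|),
       0 <= vph_psi z)
    (Psi_gt0 : forall (i : 'I_m) (z : 'cV[R]_#|vph_I Psi i|),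
       z != 0 -> 0 < vph_psi z)
    (c : 'cV[R]_n) (d : 'cV[R]_m) (b : 'cV[R]_k) (p : 'cV[R]_l)
    (A : 'M[R]_(k, n)) (B : 'M[R]_(k, m))
    (H : 'M[R]_(l, n)) (K : 'M[R]_(l, m))
    (DL_feasible :
       feasible_solution (@DL_constraint R k l)
         (omega Psi c d b p A B H K) !=set0) :
  opt_value (D_constraint Psi c d A B H K) (D_objective b p)
    = opt_value (@DL_constraint R k l) (omega Psi c d b p A B H K)
  /\ opt_solutions (D_constraint Psi c d A B H K) (D_objective b p)
    = opt_solutions (@DL_constraint R k l) (omega Psi c d b p A B H K).
Proof.
apply: opt_extend => //.
- by move=> uv [].
- by move=> uv; exact: omega_on_D.
- by move=> uv; exact: omega_off_D.
Qed.
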